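(* Let $\ell \geq 4$ be an even integer. If $m \ge 2$ is even and $n$ is an even integer with $n > \frac{\ell^2+2\ell-4}{2}$, then the honeycomb toroidal graph $\mathrm{HTG}(m,n,\ell)$ is 2-spanning cyclable.
   Context: For integers $m\ge 1$, $\ell\ge 0$ and $n\ge 4$ with $n$ even and $m-\ell$ even, the honeycomb toroidal graph $\mathrm{HTG}(m,n,\ell)$ is the simple graph with vertex set $\{u_{i,j}: 0\le i\le m-1,\ 0\le j\le n-1\}$ (first subscript computed modulo $m$, second modulo $n$) whose edge set is the set of the following unordered pairs: $\{u_{i,j},u_{i,j+1}\}$ for all $i,j$ (vertical edges); $\{u_{i,j},u_{i+1,j}\}$ for all $0\le i\le m-2$ with $i+j$ odd (flat edges); and $\{u_{m-1,j},u_{0,j+\ell}\}$ for all $j$ having the same parity as $m$ (and $\ell$) (jump edges). A 2-factor of a graph is a spanning subgraph in which every vertex has valency 2. A graph $X$ is 2-spanning cyclable if for every pair of distinct vertices $u,v$ of $X$ there is a 2-factor of $X$ consisting of exactly two cycles such that $u$ and $v$ lie in different cycles. *)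

(* Defs.v *)
From mathcomp Require Import all_boot.
From mathcomp Require Import zify.

Set Implicit Arguments.
Unset Strict Implicit.
Unset Printing Implicit Defensive.

(* A finite simple graph is a symmetric and irreflexive [e : rel V] on a
   finite type of vertices; for [htg] below both properties are proved
   under the standing assumptions on the parameters. *)

Section Graphs.
Variable V : finType.
Implicit Types (e f : rel V) (c : seq V) (u v x y : V).

Definition valency f x := #|[set y | f x y]|.

Definition two_factor e f :=
  [/\ symmetric f, subrel f e & forall x, valency f x = 2].

(* At least three pairwise distinct vertices, cyclically adjacent. *)
Definition graph_cycle e c := ucycleb e c && (2 < size c).

Definition cycle_edge c x y :=
  [&& x \in c, y \in c & (next c x == y) || (next c y == x)].

(* When [f] is a [two_factor] no vertex is isolated, so that the two cycles
   cover all the vertices. *)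
Definition consists_of_two_cycles f c1 c2 :=
  [/\ graph_cycle f c1, graph_cycle f c2, [disjoint c1 & c2] &
      forall x y, f x y = cycle_edge c1 x y || cycle_edge c2 x y].

Definition two_spanning_cyclable e :=
  forall u v, u != v ->
  exists f, two_factor e f /\
    exists c1 c2, [/\ consists_of_two_cycles f c1 c2, u \in c1 & v \in c2].

End Graphs.

Section HoneycombToroidal.
Variables m n l : nat.

(* u_{i,j} is the pair (i, j) *)
Definition htg_vertex : finType := ('I_m * 'I_n)%type.
Implicit Types u v : htg_vertex.

Definition vertical_edge u v :=
  (v.1 == u.1) && (v.2 == u.2.+1 %% n :> nat).

(* [v.1 < m] forces [u.1 <= m - 2]: flat edges do not wrap around. *)
Definition flat_edge u v :=
  [&& v.1 == u.1.+1 :> nat, v.2 == u.2 & odd (u.1 + u.2)].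

Definition jump_edge u v :=
  [&& u.1 == m.-1 :> nat, v.1 == 0 :> nat,
      v.2 == (u.2 + l) %% n :> nat & odd u.2 == odd m].

Definition htg : rel htg_vertex := fun u v =>
  [|| vertical_edge u v, flat_edge u v, jump_edge u v,
      vertical_edge v u, flat_edge v u | jump_edge v u].

Lemma htg_sym : symmetric htg.
Proof.
move=> u v; rewrite /htg.
by case: (vertical_edge u v) (vertical_edge v u) (flat_edge u v) (flat_edge v u)
  (jump_edge u v) (jump_edge v u) => [] [] [] [] [] [].
Qed.

Lemma htg_irr : 4 <= n -> ~~ odd n -> odd m = odd l -> irreflexive htg.
Proof.
move=> n4 nE ml [i j]; rewrite /htg /vertical_edge /flat_edge /jump_edge /=.
have jn := ltn_ord j; have im := ltn_ord i.
have -> : (j == j.+1 %% n :> nat) = false.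
  apply/negbTE/eqP => E; have [lt|ge] := ltnP j.+1 n.
    by move: E; rewrite modn_small //; lia.
  have e : j.+1 = n by lia.
  by move: E; rewrite e modnn; lia.
have -> : (i == i.+1 :> nat) = false by lia.
rewrite andbF /= orbb.
apply/negbTE/and4P => -[/eqP i1 /eqP i0 /eqP /(congr1 odd) E _].
move: E; rewrite odd_mod ?(negbTE nE) // oddD -ml.
have -> : m = 1 by lia.
by case: (odd j).
Qed.

End HoneycombToroidal.

Arguments htg : clear implicits.

(* Main.v *)
(** Two adjacent columns of the honeycomb torus, restricted to [l - 1] consecutive
    rows starting and ending with a flat edge, bound a strip of hexagons. Its
    boundary is one cycle. The remaining vertices are swept by a single second
    cycle that climbs column 0 block by block and visits the other columns of each
    block on the way, a block having height [l] or [l + 2] according to the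
    direction in which its jump edge is used. This needs [n - 2 l] to be of the form
    [p l + q (l + 2)], which the bound on [n] provides. Translations of the torus
    preserve the decomposition, and for [u != v] some translate of the strip
    contains [u] but not [v]. *)

Require Import Defs.
From mathcomp Require Import all_boot.
From mathcomp Require Import zify.

Set Implicit Arguments.
Unset Strict Implicit.
Unset Printing Implicit Defensive.

(** * Two-factors from two disjoint spanning cycles *)

Section TwoCycles.
Variables (V : finType) (e : rel V).
Implicit Types (x y : V) (c : seq V).

(** Otherwise two steps of [next] lead from [x] back to [x], impossible on a cycle of at least three
    vertices. *)
Lemma next_neq_prev c x : uniq c -> 2 < size c -> x \in c ->
  next c x != prev c x.
Proof.
move=> uc sc xc; apply/eqP => E.
have nn : next c (next c x) = x by rewrite E next_prev.
have [i s Ec] := rot_to xc.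
have us : uniq (x :: s) by rewrite -Ec rot_uniq.
move: nn sc; rewrite -!(next_rot i uc) Ec -(size_rot i c) Ec.
case: s us {Ec} => [|a [|b s]] //= /andP[xn _].
move: xn; rewrite !inE !negb_or => /and3P[xa xb _].
rewrite eqxx (eq_sym a) (negbTE xa) eqxx => bx _.
by rewrite bx eqxx in xb.
Qed.

Lemma cycle_edgeE c x y : uniq c -> x \in c ->
  cycle_edge c x y = (y == next c x) || (y == prev c x).
Proof.
move=> uc xc; rewrite /cycle_edge xc /= (eq_sym y).
have [<-|_] /= := eqVneq (next c x) y; first by rewrite mem_next xc.
apply/andP/eqP => [[_ /eqP <-]|->]; first by rewrite prev_next.
by rewrite mem_prev xc next_prev.
Qed.

Lemma cycle_edge_sym c : symmetric (cycle_edge c).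
Proof. by move=> x y; rewrite /cycle_edge andbCA orbC. Qed.

Lemma cycle_edge_sub c : symmetric e -> cycle e c -> subrel (cycle_edge c) e.
Proof.
move=> es ec x y /and3P[xc yc /orP[]/eqP <-]; last rewrite es;
  exact: next_cycle.
Qed.

Lemma cycle_edge_cycle c : uniq c -> cycle (cycle_edge c) c.
Proof.
move=> uc; apply: cycle_from_next => // x xc.
by rewrite cycle_edgeE // eqxx.
Qed.

Lemma two_cycles_two_factor c1 c2 : symmetric e ->
    graph_cycle e c1 -> graph_cycle e c2 -> [disjoint c1 & c2] ->
    (forall x, (x \in c1) || (x \in c2)) ->
  exists f, two_factor e f /\ consists_of_two_cycles f c1 c2.
Proof.
move=> es /andP[/andP[ec1 u1] s1] /andP[/andP[ec2 u2] s2] dis cov.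
exists (fun x y => cycle_edge c1 x y || cycle_edge c2 x y).
have valc c x : uniq c -> 2 < size c -> x \in c ->
    #|[set y | cycle_edge c x y]| = 2.
  move=> uc sc xc; rewrite -[RHS](_ : #|[set next c x; prev c x]| = 2).
    by apply: eq_card => y; rewrite !inE cycle_edgeE.
  by rewrite cards2 next_neq_prev.
have dis21 : [disjoint c2 & c1] by rewrite disjoint_sym.
split; split.
- by move=> x y; rewrite !(cycle_edge_sym _ x).
- by move=> x y /orP[]; apply: cycle_edge_sub.
- move=> x; rewrite /valency; have /orP[xc|xc] := cov x.
    rewrite -(valc c1 x) //; apply: eq_card => y; rewrite !inE.
    by rewrite [cycle_edge c2 x y]/cycle_edge (disjointFr dis xc) orbF.
  rewrite -(valc c2 x) //; apply: eq_card => y; rewrite !inE.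
  by rewrite [cycle_edge c1 x y]/cycle_edge (disjointFr dis21 xc).
- rewrite /graph_cycle /ucycleb u1 s1 !andbT.
  by apply: sub_cycle (cycle_edge_cycle u1) => x y ->.
- rewrite /graph_cycle /ucycleb u2 s2 !andbT.
  by apply: sub_cycle (cycle_edge_cycle u2) => x y ->; rewrite orbT.
- by [].
- by [].
Qed.

End TwoCycles.

(** * Walks with prescribed ends *)

Section Walks.
Variables (V : eqType) (e : rel V).
Implicit Types (x y z : V) (s : seq V).

(** Here [s] lists both ends, so joining and reversing walks are plain [++] and [rev]. Repetitions
    are allowed: they are excluded later, by counting. *)
Definition walk x y s :=
  if s is z :: p then [&& z == x, last z p == y & path e z p] else false.

Lemma walk_cat x y z w s s' :
  walk x y s -> e y z -> walk z w s' -> walk x w (s ++ s').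
Proof.
case: s s' => [|a p] //= [|b q] //= /and3P[-> /eqP Ey pp] eyz.
case/and3P=> /eqP-> /eqP wE pq.
by rewrite last_cat /= wE eqxx cat_path /= pp Ey eyz.
Qed.

Lemma walk_rev x y s : symmetric e -> walk x y s -> walk y x (rev s).
Proof.
move=> es; elim: s x => [//|a [|b p] IH] x /and3P[/eqP-> /=].
  by move=> /eqP-> _; rewrite !eqxx.
move=> ly /andP[eab pb].
rewrite rev_cons -cats1; apply: (walk_cat (y := b) (z := x)).
- by apply: IH; rewrite /walk eqxx ly.
- by rewrite es.
- by rewrite /walk /= !eqxx.
Qed.

Lemma walk_cycle x y s : walk x y s -> e y x -> cycle e s.
Proof.
case: s => [//|a p] /and3P[/eqP-> /eqP ly pp] eyx.
by rewrite /= rcons_path pp ly.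
Qed.

End Walks.

(* The honeycomb torus unrolled to the plane: jump edges become flat edges, and
   moving by [m] columns amounts to moving by [l] rows. *)
Record honeycomb_chart (V : eqType) (e : rel V) (m n l : nat)
    (W : nat -> nat -> V) : Prop := HoneycombChart {
  chart_vertical : forall i j, e (W i j) (W i j.+1);
  chart_flat : forall i j, odd (i + j) -> e (W i j) (W i.+1 j);
  chart_column : forall i j, W (i + m) j = W i (j + l);
  chart_row : forall i j, W i (j + n) = W i j;
  chart_onto : forall v, exists i j, v = W i j }.

(** * Periodicity and translations of a chart *)

Section Chart.
Variables (V : finType) (e : rel V) (m n l : nat) (W : nat -> nat -> V).
Hypotheses (es : symmetric e) (m_gt0 : 0 < m) (n_gt0 : 0 < n).
Hypothesis cW : honeycomb_chart e m n l W.

Lemma chart_rowM i j k : W i (j + k * n) = W i j.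
Proof.
by elim: k => [|k IH]; rewrite ?addn0 // mulSn addnCA addnC (chart_row cW).
Qed.

Lemma chart_mod i j : W i (j %% n) = W i j.
Proof. by rewrite {2}(divn_eq j n) addnC chart_rowM. Qed.

Lemma chart_columnM i j k : W (i + k * m) j = W i (j + k * l).
Proof.
elim: k j => [|k IH] j; first by rewrite !addn0.
by rewrite !mulSn addnCA addnC (chart_column cW) IH addnA.
Qed.

Lemma chart_reduced v : exists i j, [/\ i < m, j < n & v = W i j].
Proof.
have [i [j ->]] := chart_onto cW v.
exists (i %% m), ((j + i %/ m * l) %% n).
by rewrite !ltn_mod m_gt0 n_gt0 chart_mod -chart_columnM addnC -divn_eq.
Qed.

Lemma chart_beyond p q v : exists i j, [/\ p <= i, q <= j & v = W i j].
Proof.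
have [i [j ->]] := chart_onto cW v.
(* The [p * m] extra columns amount to [p * l] rows; [p * l * n.-1] more rows complete them to a
   multiple of [n]. *)
exists (i + p * m), (j + p * l * n.-1 + q * n).
split; [exact: leq_trans (leq_pmulr p m_gt0) (leq_addl _ _)
       |exact: leq_trans (leq_pmulr q n_gt0) (leq_addl _ _)|].
rewrite chart_columnM -addnA [q * n + _]addnC addnA chart_rowM.
rewrite -addnA -{2}[p * l]muln1 -mulnDr addn1 prednK //.
by rewrite chart_rowM.
Qed.

(** Flat edges depend on the parity of [i + j], which an even shift keeps. The translate is still
    onto because every vertex has coordinates at least [p] and [q]. *)
Lemma chart_translate p q : ~~ odd (p + q) ->
  honeycomb_chart e m n l (fun i j => W (i + p) (j + q)).
Proof.
move=> pq; split.
- by move=> i j; rewrite addSn; apply: (chart_vertical cW).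
- move=> i j ij; rewrite addSn; apply: (chart_flat cW); lia.
- by move=> i j; rewrite addnAC (chart_column cW) addnAC.
- by move=> i j; rewrite addnAC (chart_row cW).
- move=> v; have [i [j [pi qj ->]]] := chart_beyond p q v.
  by exists (i - p), (j - q); rewrite !subnK.
Qed.

(** * Columns, snakes and arms *)

Definition up i a k := [seq W i j | j <- iota a k].

Lemma mem_up i a k j : a <= j < a + k -> W i j \in up i a k.
Proof. by move=> jk; rewrite map_f // mem_iota. Qed.

Lemma size_up i a k : size (up i a k) = k.
Proof. by rewrite size_map size_iota. Qed.

Lemma walk_up i a k : walk e (W i a) (W i (a + k)) (up i a k.+1).
Proof.
elim: k a => [|k IH] a; first by rewrite addn0 /up /= !eqxx.
rewrite -addSnnS; apply: (@walk_cat _ _ _ (W i a) _ _ [:: W i a]) (IH a.+1).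
- by rewrite /= !eqxx.
- exact: (chart_vertical cW).
Qed.

(* Boustrophedon through the columns [i, ..., i + 2 c - 1]. *)
Fixpoint snake i x h c :=
  if c is c'.+1 then up i x h ++ rev (up i.+1 x h) ++ snake i.+2 x h c'
  else [::].

Lemma snakeS i x h c :
  snake i x h c.+1 = up i x h ++ rev (up i.+1 x h) ++ snake i.+2 x h c.
Proof. by []. Qed.

(** Column 1 has its own height [k] because the strip removes its top rows: [k] differs from [h] in
    the last arm only. *)
Definition arm x k h := rev (up 1 x k) ++ snake 2 x h (m./2).-1.

Lemma size_snake i x h c : size (snake i x h c) = c.*2 * h.
Proof.
elim: c i => //= c IH i.
by rewrite !size_cat size_rev !size_up IH doubleS !mulSn.
Qed.

Lemma size_arm x k h : ~~ odd m -> size (arm x k h) = k + (m - 2) * h.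
Proof.
move=> mE; rewrite size_cat size_rev size_up size_snake.
by have -> : (m./2).-1.*2 = m - 2 by lia.
Qed.

Lemma mem_snake i x h c a j : i <= a < i + c.*2 -> x <= j < x + h ->
  W a j \in snake i x h c.
Proof.
move=> ai jx; elim: c i ai => [|c IH] i ai /=; first by lia.
rewrite 2!mem_cat mem_rev.
have [->|ne] := eqVneq a i; first by rewrite mem_up.
have [->|ne'] := eqVneq a i.+1; first by rewrite mem_up // orbT.
by rewrite IH ?orbT //; lia.
Qed.

Lemma mem_arm_high x k h i j : ~~ odd m -> 2 <= i < m -> x <= j < x + h ->
  W i j \in arm x k h.
Proof. by move=> mE im jx; rewrite mem_cat mem_snake ?orbT //; lia. Qed.

Lemma mem_arm1 x k h j : x <= j < x + k -> W 1 j \in arm x k h.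
Proof. by move=> jx; rewrite mem_cat mem_rev mem_up. Qed.

(** Flat edges leave odd columns at the even bottom row [x] and even columns at the odd top row
    [x + h]. The prefix [s] makes the induction append two columns at a time. *)
Lemma walk_snake i x h c s y : ~~ odd i -> ~~ odd x -> odd h ->
  walk e y (W i.+1 x) s ->
  walk e y (W (i.+1 + c.*2) x) (s ++ snake i.+2 x h.+1 c).
Proof.
move=> iE xE hO; elim: c i s iE => [|c IH] i s iE ws.
  by rewrite cats0 addn0.
have -> : i.+1 + c.+1.*2 = i.+3 + c.*2 by lia.
rewrite snakeS !catA; apply: IH; first by rewrite /= negbK.
apply: (walk_cat (y := W i.+2 (x + h))) (walk_rev es (walk_up i.+3 x h)).
  apply: walk_cat ws _ (walk_up i.+2 x h).
  by apply: (chart_flat cW); lia.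
by apply: (chart_flat cW); lia.
Qed.

Lemma walk_arm x k h : ~~ odd m -> ~~ odd x -> ~~ odd h -> 0 < k -> 0 < h ->
  walk e (W 1 (x + k.-1)) (W m.-1 x) (arm x k h).
Proof.
case: h k => // h [] // k mE xE hE _ _.
have -> : m.-1 = 1 + (m./2).-1.*2 by lia.
apply: walk_snake => //; first by rewrite -[odd h]negbK.
exact: walk_rev (walk_up 1 x k).
Qed.

(* The part of the Hamilton cycle on the complement of the strip that starts at
   the bottom [W 0 (x - d)] of a block. A block of height [l] climbs column 0 and
   goes back along its arm; in a block of height [l + 2] the arm is entered
   backwards, through the jump edge, and left through column 1. *)
Definition tail_walk x d := exists s,
  [/\ walk e (W 0 (x - d)) (W m.-1 (n - l)) s,
      size s = (n - l + 1 - (x - d)) + (n - l + 1 - x) + (m - 2) * (n - x),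
      forall j, x - d <= j <= n - l -> W 0 j \in s,
      forall j, x <= j <= n - l -> W 1 j \in s &
      forall i j, 2 <= i < m -> x <= j < n -> W i j \in s].

(** * The second cycle, block by block from the top *)

Hypotheses (mE : ~~ odd m) (lE : ~~ odd l) (nE : ~~ odd n).
Hypotheses (m_ge2 : 2 <= m) (l_gt0 : 0 < l) (ln : 2 * l <= n).

Lemma chart_jump j : ~~ odd j -> e (W m.-1 j) (W 0 (j + l)).
Proof.
move=> jE; rewrite -(chart_column cW) add0n -{2}(prednK m_gt0).
by apply: (chart_flat cW); lia.
Qed.

(** The strip leaves columns 0 and 1 free only up to row [n - l]. The first arm is run backwards
    from its jump edge up to column 1; one vertical edge then leads to the second arm, which has a
    single vertex in column 1. *)
Lemma tail_walk_last d : d <= n - 2 * l -> tail_walk (n - 2 * l) d.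
Proof.
set x := n - 2 * l => dx; have xE : ~~ odd x by lia.
exists (up 0 (x - d) (l + d).+1 ++ rev (arm x l l) ++ arm (x + l) 1 l).
have nl : n - l = x + l by lia.
split.
- rewrite nl; apply: walk_cat (walk_up _ _ _) _ _.
    have -> : x - d + (l + d) = x + l by lia.
    by rewrite es; apply: chart_jump.
  have w : walk e (W 1 (x + l)) (W m.-1 (x + l)) (arm (x + l) 1 l).
    by have := @walk_arm (x + l) 1 l; rewrite addn0; apply; lia.
  apply: walk_cat (walk_rev es _) _ w; first by apply: walk_arm; lia.
  have -> : x + l = (x + l.-1).+1 by lia.
  by apply: (chart_vertical cW).
- rewrite 2!size_cat size_rev !size_arm // size_up.
  have -> : n - x = l + l by lia.
  by rewrite mulnDr; lia.
- by move=> j jx; rewrite !mem_cat mem_up //; lia.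
- move=> j jx; rewrite 2!mem_cat mem_rev.
  have [lt|ge] := ltnP j (x + l); first by rewrite mem_arm1 ?orbT //; lia.
  by rewrite [W 1 j \in arm (x + l) _ _]mem_arm1 ?orbT //; lia.
- move=> i j im jx; rewrite 2!mem_cat mem_rev.
  have [lt|ge] := ltnP j (x + l); first by rewrite mem_arm_high ?orbT //; lia.
  by rewrite [W i j \in arm (x + l) _ _]mem_arm_high ?orbT //; lia.
Qed.

Lemma tail_walk_short x d : ~~ odd x -> d <= x -> x + l <= n - l ->
  tail_walk (x + l) 0 -> tail_walk x d.
Proof.
move=> xE dx xn [s [ws ss s0 s1 s2]].
have dlK : (l + d).-1.+1 = l + d by lia.
exists (up 0 (x - d) (l + d) ++ arm x l l ++ s); split.
- rewrite -dlK; apply: walk_cat (walk_up _ _ _) _ _.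
    have -> : x - d + (l + d).-1 = x + l.-1 by lia.
    by apply: (chart_flat cW); lia.
  apply: walk_cat ws; first by apply: walk_arm; lia.
  by rewrite subn0; apply: chart_jump.
- rewrite 2!size_cat ss !size_arm // size_up.
  have -> : n - x = l + (n - (x + l)) by lia.
  by rewrite mulnDr; lia.
- move=> j jx; rewrite 2!mem_cat.
  have [lt|ge] := ltnP j (x + l); first by rewrite mem_up //; lia.
  by rewrite s0 ?orbT //; lia.
- move=> j jx; rewrite 2!mem_cat.
  have [lt|ge] := ltnP j (x + l); first by rewrite mem_arm1 ?orbT //; lia.
  by rewrite s1 ?orbT //; lia.
- move=> i j im jx; rewrite 2!mem_cat.
  have [lt|ge] := ltnP j (x + l); first by rewrite mem_arm_high ?orbT //; lia.
  by rewrite s2 ?orbT //; lia.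
Qed.

(** Column 0 is climbed only to row [x + l], the end of the jump edge. Its row [x + l + 1] is where
    the arm returns, so it is passed to the next block, as the offset 1. *)
Lemma tail_walk_long x d : ~~ odd x -> d <= x -> x + l + 2 <= n - l ->
  tail_walk (x + l + 2) 1 -> tail_walk x d.
Proof.
move=> xE dx xn [s [ws ss s0 s1 s2]].
exists (up 0 (x - d) (l + d).+1 ++ rev (arm x l.+2 l.+2) ++ s); split.
- apply: walk_cat (walk_up _ _ _) _ _.
    have -> : x - d + (l + d) = x + l by lia.
    by rewrite es; apply: chart_jump.
  apply: walk_cat (walk_rev es _) _ ws; first by apply: walk_arm; lia.
  have -> : x + l + 2 - 1 = x + l.+2.-1 by lia.
  by rewrite es; apply: (chart_flat cW); lia.
- rewrite 2!size_cat ss size_rev !size_arm // size_up.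
  have -> : n - x = l.+2 + (n - (x + l + 2)) by lia.
  by rewrite mulnDr; lia.
- move=> j jx; rewrite 2!mem_cat.
  have [lt|ge] := ltnP j (x + l).+1; first by rewrite mem_up //; lia.
  by rewrite s0 ?orbT //; lia.
- move=> j jx; rewrite 2!mem_cat mem_rev.
  have [lt|ge] := ltnP j (x + l.+2); first by rewrite mem_arm1 ?orbT //; lia.
  by rewrite s1 ?orbT //; lia.
- move=> i j im jx; rewrite 2!mem_cat mem_rev.
  have [lt|ge] := ltnP j (x + l.+2); first by rewrite mem_arm_high ?orbT //; lia.
  by rewrite s2 ?orbT //; lia.
Qed.

Lemma tail_walk_from0 p q : n - 2 * l = p * l + q * (l + 2) -> tail_walk 0 0.
Proof.
move=> pq.
(* Blocks are added downwards: [q] long ones below the last, then [p] short ones, down to row 0. The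
   offset [d] stays free since it depends on the block added next. *)
have tl r : r <= q -> forall d, d <= n - 2 * l - r * (l + 2) ->
    tail_walk (n - 2 * l - r * (l + 2)) d.
  elim: r => [|r IH] rq d; first by rewrite subn0; apply: tail_walk_last.
  have rqM : r.+1 * (l + 2) <= q * (l + 2) by rewrite leq_mul2r rq orbT.
  rewrite mulSn in rqM *; move=> dx; apply: tail_walk_long => //; try lia.
  have -> : n - 2 * l - (l + 2 + r * (l + 2)) + l + 2 = n - 2 * l - r * (l + 2).
    by lia.
  by apply: IH; lia.
have ts r : r <= p -> forall d, d <= n - 2 * l - q * (l + 2) - r * l ->
    tail_walk (n - 2 * l - q * (l + 2) - r * l) d.
  elim: r => [|r IH] rp d; first by rewrite subn0; apply: tl.
  have rpM : r.+1 * l <= p * l by rewrite leq_mul2r rp orbT.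
  rewrite mulSn in rpM *; move=> dx; apply: tail_walk_short => //; try lia.
  have -> : n - 2 * l - q * (l + 2) - (l + r * l) + l
      = n - 2 * l - q * (l + 2) - r * l by lia.
  by apply: IH; lia.
have := ts p (leqnn p) 0 isT.
by have -> : n - 2 * l - q * (l + 2) - p * l = 0 by lia.
Qed.

(** * The strip and its complement *)

Hypotheses (cardV : #|V| = m * n) (l_gt2 : 2 < l).

Lemma strip_two_factor p q : n - 2 * l = p * l + q * (l + 2) ->
  exists f c1 c2, [/\ two_factor e f, consists_of_two_cycles f c1 c2,
    forall i j, i < 2 -> n - l < j < n -> W i j \in c1 &
    forall i j, i < m -> j < n -> (i < 2 -> j <= n - l) -> W i j \in c2].
Proof.
move=> /tail_walk_from0[c2 [w2 sz2 m0 m1 m2]].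
set y := n - l + 1.
pose c1 := up 0 y l.-2.+1 ++ rev (up 1 y l.-2.+1).
have w1 : walk e (W 0 y) (W 1 y) c1.
  apply: walk_cat (walk_up _ _ _) _ (walk_rev es (walk_up _ _ _)).
  by apply: (chart_flat cW); lia.
have sz1 : size c1 = 2 * (l - 1) by rewrite size_cat size_rev !size_up; lia.
have in1 i j : i < 2 -> n - l < j < n -> W i j \in c1.
  rewrite mem_cat mem_rev; case: i => [|[|//]] _ jn; rewrite mem_up ?orbT //; lia.
have in2 i j : i < m -> j < n -> (i < 2 -> j <= n - l) -> W i j \in c2.
  case: i => [|[|i]] im jn jl.
  - by apply: m0; rewrite jl.
  - by apply: m1; rewrite jl.
  - by apply: m2.
have cov v : (v \in c1) || (v \in c2).
  have [i [j [im jn ->]]] := chart_reduced v.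
  have [/andP[i2 jl]|] := boolP ((i < 2) && (n - l < j)).
    by rewrite in1 // jl.
  by move=> nij; rewrite [_ \in c2]in2 ?orbT //; lia.
(* The two lists cover all vertices and their total length is [m * n], so nothing is repeated: this
   gives both simplicity and disjointness. *)
have uc : uniq (c1 ++ c2).
  apply: (leq_size_uniq (enum_uniq V)) => [v _|]; first by rewrite mem_cat.
  rewrite size_cat sz1 sz2 -cardE cardV !subn0.
  have -> : m * n = 2 * n + (m - 2) * n by rewrite -mulnDl subnKC.
  by lia.
move: uc; rewrite cat_uniq => /and3P[u1 dis u2].
have [f [tf cf]] : exists f, two_factor e f /\ consists_of_two_cycles f c1 c2.
  apply: two_cycles_two_factor => //.
  - rewrite /graph_cycle /ucycleb u1 sz1 (walk_cycle w1) /=; first by lia.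
    by rewrite es; apply: (chart_flat cW); lia.
  - rewrite /graph_cycle /ucycleb u2 sz2 (walk_cycle w2) /=.
      by apply: leq_trans (leq_addr _ _); lia.
    (* The closing edge is the jump from row [n - l] to row [n], which is row 0. *)
    have nK : n - l + l = 0 + n by lia.
    by rewrite subn0 -(chart_row cW 0 0) -nK; apply: chart_jump; lia.
  - by rewrite disjoint_sym disjoint_has.
by exists f, c1, c2.
Qed.

End Chart.

(* Translations preserve the parity of [i + j]; both parities occur at the ends of
   the columns of the strip. Putting [u] at such an end, or next to one in the
   other column when [v] is its neighbour across the strip, leaves [v] outside. *)
Lemma chart_two_spanning_cyclable (V : finType) (e : rel V) m n l W p q :
    symmetric e -> honeycomb_chart e m n l W -> #|V| = m * n ->
    ~~ odd m -> ~~ odd l -> ~~ odd n -> 2 <= m -> 4 <= l -> 2 * l <= n ->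
    n - 2 * l = p * l + q * (l + 2) ->
  two_spanning_cyclable e.
Proof.
move=> es cW cV mE lE nE m2 l4 ln pq u v uv.
have m0 : 0 < m by lia.
have n0 : 0 < n by lia.
(* The bounds 1 and [n] make [i0 - a] and [j0 - r] exact for every position [(a, r)] in the
   strip. *)
have [i0 [j0 [i0_ge j0_ge uE]]] := chart_beyond m0 n0 cW 1 n u.
have [i [j [im jn vE]]] : exists i j, [/\ i < m, j < n & v = W (i0 + i) (j0 + j)].
  have [a [b [ai bj ->]]] := chart_beyond m0 n0 cW i0 j0 v.
  set k := (a - i0) %/ m.
  exists ((a - i0) %% m), ((b - j0 + k * l) %% n).
  rewrite !ltn_mod m0 n0; split=> //.
  rewrite -[RHS](chart_mod cW) modnDmr (chart_mod cW) addnA -(chart_columnM cW).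
  by rewrite -addnA [_ %% m + _]addnC -divn_eq !subnKC.
(* Translating [u] to [(a, r)] in the strip takes [v] to [(i', s)] after [k] turns around the
   columns and [t] around the rows. *)
have place a r i' s k t : a < 2 -> n - l < r < n ->
    odd (a + r) = odd (i0 + j0) -> i' < m -> s < n -> (i' < 2 -> s <= n - l) ->
    a + i = i' + k * m -> r + j + k * l = s + t * n ->
  exists f, two_factor e f /\
    exists c1 c2, [/\ consists_of_two_cycles f c1 c2, u \in c1 & v \in c2].
  move=> a2 rn par i'm sn i's Ei Ej.
  have E : ~~ odd (i0 - a + (j0 - r)) by lia.
  have cW' := chart_translate m0 n0 cW E.
  have [f [c1 [c2 [tf cf in1 in2]]]] :=
    strip_two_factor es m0 n0 cW' mE lE nE m2 (ltnW (ltnW (ltnW l4))) ln cV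
      (ltnW l4) pq.
  exists f; split=> //; exists c1, c2; split=> //.
    have := in1 a r a2 rn.
    by rewrite uE; have [-> ->] : a + (i0 - a) = i0 /\ r + (j0 - r) = j0 by lia.
  rewrite vE; have := in2 i' s i'm sn i's.
  rewrite -(chart_rowM cW _ _ t).
  have -> : s + (j0 - r) + t * n = j0 + j + k * l by lia.
  rewrite -(chart_columnM cW).
  by have -> : i' + (i0 - a) + k * m = i0 + i by lia.
have ij0 : 0 < i + j.
  rewrite lt0n addn_eq0; apply: contraNN uv => /andP[/eqP i_0 /eqP j_0].
  by rewrite uE vE i_0 j_0 !addn0.
have [uO|uE'] := boolP (odd (i0 + j0)).
  have [i1|i1] := eqVneq i 1; last first.
    have [i_0|i_0] := eqVneq i 0; last first.
      have [jlt|jge] := ltnP j 1.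
        by apply: (place 0 (n - 1) i (n - 1 + j) 0 0); lia.
      by apply: (place 0 (n - 1) i (j - 1) 0 1); lia.
    (* With [v] in the column of [u], one of the two ends of that column always works: the top one
       for small [j], the bottom one otherwise. *)
    have [jlt|jge] := leqP j (n - l + 1).
      by apply: (place 0 (n - 1) 0 (j - 1) 0 1); lia.
    by apply: (place 0 (n - l + 1) 0 (j + 1 - l) 0 1); lia.
  (* Here [v] is the flat neighbour of [u]. With [u] in column 1, [v] falls in column 2, which for
     [m = 2] is column 0 shifted by [l] rows. *)
  have [j_0|j_0] := eqVneq j 0.
    have [m_2|m_2] := eqVneq m 2.
      by apply: (place 1 (n - 2) 0 (l - 2) 1 1); lia.
    by apply: (place 1 (n - 2) 2 (n - 2) 0 0); lia.
  have [jlt|jge] := leqP j (n - l + 1).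
    by apply: (place 0 (n - 1) 1 (j - 1) 0 1); lia.
  by apply: (place 0 (n - l + 1) 1 (j + 1 - l) 0 1); lia.
have [i_0|i_0] := eqVneq i 0.
  have [jlt|jge] := leqP j (n - l + 1).
    by apply: (place 1 (n - 1) 1 (j - 1) 0 1); lia.
  by apply: (place 1 (n - l + 1) 1 (j + 1 - l) 0 1); lia.
have [i1|i1] := ltnP i (m - 1).
  have [jlt|jge] := ltnP j 1.
    by apply: (place 1 (n - 1) i.+1 (n - 1 + j) 0 0); lia.
  by apply: (place 1 (n - 1) i.+1 (j - 1) 0 1); lia.
have [m_2|m_2] := eqVneq m 2; last first.
  have [jlt|jge] := ltnP j 2.
    by apply: (place 0 (n - 2) i (n - 2 + j) 0 0); lia.
  by apply: (place 0 (n - 2) i (j - 2) 0 1); lia.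
have [j1|j1] := leqP j (n - l - 1).
  by apply: (place 1 (n - l + 1) 0 (j + 1) 1 1); lia.
(* For [m = 2], this [v] is the neighbour of [u] across the strip: one column to the right and [l]
   rows down is one column to the left. *)
have [j2|j2] := eqVneq j (n - l).
  by apply: (place 0 (n - 2) 1 (n - l - 2) 0 1); lia.
by apply: (place 1 (n - 1) 0 (j + l - 1 - n) 1 2); lia.
Qed.

(** * The chart of the honeycomb toroidal graph *)

Section Torus.
Variables (m n l : nat) (m_gt0 : 0 < m) (n_gt0 : 0 < n).

Definition unrolled i j : htg_vertex m n :=
  (Ordinal (ltn_pmod i m_gt0), Ordinal (ltn_pmod (j + i %/ m * l) n_gt0)).

(** As [m], [l] and [n] are even, reduction keeps the parity of both coordinates. A flat edge of the
    plane becomes a jump edge exactly when it leaves a column congruent to [m.-1]. *)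
Lemma unrolled_chart : ~~ odd m -> ~~ odd l -> ~~ odd n ->
  honeycomb_chart (htg m n l) m n l unrolled.
Proof.
move=> mE lE nE.
have oddmod d k : ~~ odd d -> odd (k %% d) = odd k.
  by move=> dE; rewrite odd_mod ?(negbTE dE).
split=> [i j|i j ij|i j|i j|[a b]].
- apply/or4P/Or41; rewrite /vertical_edge /= eqxx /=.
  by rewrite -[(_ %% n).+1]addn1 modnDml addn1 addSn.
- have jO : odd (j + i %/ m * l) = odd j.
    by rewrite oddD oddM (negbTE lE) andbF addbF.
  have [im|im] := eqVneq (i %% m) m.-1.
    have Ei : i.+1 = (i %/ m).+1 * m.
      by have := divn_eq i m; rewrite im mulSn; lia.
    apply/orP; right; apply/orP; right; apply/orP; left.
    rewrite /jump_edge /= im Ei modnMl mulnK // modnDml mulSn addnAC addnA.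
    rewrite !eqxx /=.
    by rewrite oddmod // jO; move: ij; rewrite oddD -(oddmod m i mE) im; lia.
  have lt : (i %% m).+1 < m.
    by move: im (ltn_pmod i m_gt0); move: (i %% m) => r; lia.
  have Ei : i.+1 = i %/ m * m + (i %% m).+1 by rewrite addnS -divn_eq.
  have dS : i.+1 %/ m = i %/ m.
    by rewrite Ei divnMDl // (divn_small lt) addn0.
  have mS : i.+1 %% m = (i %% m).+1 by rewrite Ei modnMDl modn_small.
  apply/orP; right; apply/orP; left.
  rewrite /flat_edge /= mS -val_eqE /= dS !eqxx /= oddD !oddmod // jO.
  by rewrite -oddD.
- congr pair; apply: val_inj; rewrite /= ?modnDr //.
  by rewrite divnDr // divnn m_gt0 mulnDl mul1n addnAC -addnA.
- by congr pair; apply: val_inj; rewrite /= addnAC modnDr.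
- exists a, b; congr pair; apply: val_inj => /=; first by rewrite modn_small.
  by rewrite divn_small // addn0 modn_small.
Qed.

End Torus.

(* [k (k - 1)] is one more than the Frobenius number of [k] and [k + 1]. *)
Lemma sum_of_consecutive k N : 0 < k -> k * k.-1 <= N ->
  exists p q, N = p * k + q * k.+1.
Proof.
(* Of the [N %/ k] parts equal to [k], [N %% k] are enlarged by one to absorb the remainder; there
   are enough of them since [N %% k <= k.-1 <= N %/ k]. *)
move=> k0 kN; exists (N %/ k - N %% k), (N %% k).
have le : N %% k <= N %/ k.
  have r_lt : N %% k < k by rewrite ltn_mod.
  have : k.-1 <= N %/ k by rewrite leq_divRL // mulnC.
  by move: r_lt; move: (N %% k) (N %/ k) => r s; lia.
rewrite mulnBl mulnS; have := divn_eq N k; have := leq_mul le (leqnn k).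
by lia.
Qed.

Theorem theorem5p3 (m n l : nat) (l_ge4 : 4 <= l) (l_even : ~~ odd l)
    (m_ge2 : 2 <= m) (m_even : ~~ odd m) (n_even : ~~ odd n)
    (n_large : (l ^ 2 + 2 * l - 4) %/ 2 < n) :
  two_spanning_cyclable (htg m n l).
Proof.
have [k lk] : exists k, l = 2 * k by exists l./2; lia.
have [N nN] : exists N, n = 2 * N by exists n./2; lia.
(* Halving turns the block heights [l] and [l + 2] into [k] and [k.+1]. The bound on [n] reads
   [2 * N > 2 * k ^ 2 + 2 * k - 2], that is [N >= k ^ 2 + k]. *)
have kN : k * k.-1 <= N - 2 * k.
  have : k * k + k <= N.
    have E : l ^ 2 + 2 * l - 4 = (2 * (k * k) + 2 * k - 2) * 2 by rewrite lk; lia.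
    by move: n_large; rewrite E mulnK //; lia.
  have : k * k = k * k.-1 + k by rewrite -mulnSr prednK //; lia.
  by lia.
have [p [q pq]] : exists p q, N - 2 * k = p * k + q * k.+1.
  by apply: sum_of_consecutive; lia.
have ln : 2 * l <= n.
  by have : k * 1 <= k * k.-1; [rewrite leq_mul2l; lia | lia].
have m0 : 0 < m by lia.
have n0 : 0 < n by lia.
apply: (chart_two_spanning_cyclable (p := p) (q := q) _
  (unrolled_chart m0 n0 m_even l_even n_even)) => //.
- exact: htg_sym.
- by rewrite card_prod !card_ord.
- by rewrite lk nN; lia.
Qed.
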